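(* The exponential generating function for nonnesting permutations that avoid $\{1231,1321\}$ is $$\sum_{n\ge0} c_n(1231,1321)\,\frac{x^n}{n!}=\frac{2}{3-e^{2x}}.$$
   Context: A word $\pi=\pi_1\dots\pi_m$ over the positive integers contains the pattern $\sigma=\sigma_1\dots\sigma_k$ if there are indices $1\le i_1<\dots<i_k\le m$ such that for all $r,s\in\{1,\dots,k\}$: $\pi_{i_r}<\pi_{i_s}$ iff $\sigma_r<\sigma_s$, and $\pi_{i_r}=\pi_{i_s}$ iff $\sigma_r=\sigma_s$; otherwise $\pi$ avoids $\sigma$. $\mathcal{C}_n$ denotes the set of nonnesting permutations: arrangements (words) of the multiset $\{1,1,2,2,\dots,n,n\}$ that avoid the patterns $1221$ and $2112$ ($\mathcal{C}_0$ consists of the empty word only). For patterns $\sigma,\tau,\dots$, $c_n(\sigma,\tau,\dots)$ is the number of $\pi\in\mathcal{C}_n$ avoiding all of $\sigma,\tau,\dots$. The identity is one of formal power series in $x$. *)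

(* Defs.v *)
From mathcomp Require Import all_boot all_order all_algebra.
Import GRing.Theory.

Set Implicit Arguments.
Unset Strict Implicit.
Unset Printing Implicit Defensive.

Local Open Scope nat_scope.

(* Words are sequences over nat; f r is the (0-based) position i_r. *)
Definition contains_pattern (w sigma : seq nat) : bool :=
  [exists f : {ffun 'I_(size sigma) -> 'I_(size w)},
    [forall r : 'I_(size sigma), [forall s : 'I_(size sigma),
      [&& (r < s) ==> (f r < f s),
          (nth 0 w (f r) < nth 0 w (f s)) == (nth 0 sigma r < nth 0 sigma s)
        & (nth 0 w (f r) == nth 0 w (f s))
            == (nth 0 sigma r == nth 0 sigma s)]]]].

Definition avoids (w sigma : seq nat) : bool := ~~ contains_pattern w sigma.

Definition double_multiset (n : nat) : seq nat := iota 1 n ++ iota 1 n.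

(* [permutations s] lists each distinct rearrangement of s exactly once, even
   when s has repeated letters. *)
Definition nonnesting_perms (n : nat) : seq (seq nat) :=
  [seq w <- permutations (double_multiset n)
     | avoids w [:: 1; 2; 2; 1] && avoids w [:: 2; 1; 1; 2]].

Definition num_avoiding (patterns : seq (seq nat)) (n : nat) : nat :=
  size [seq w <- nonnesting_perms n | all (avoids w) patterns].

Local Open Scope ring_scope.

(* A formal power series over the rationals is its coefficient sequence;
   equality of series is pointwise equality [=1]. *)
Definition fps : Type := nat -> rat.

Definition fps_const (a : rat) : fps := fun n => if n == 0%N then a else 0.

Definition fps_sub (f g : fps) : fps := fun n => f n - g n.

Definition fps_mul (f g : fps) : fps :=
  fun n => \sum_(i < n.+1) f i * g (n - i)%N.

(* The first n coefficients of 1/f, each obtained by solving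
   \sum_(i <= m) f (m - i) * g i = (m == 0) for g m. *)
Fixpoint fps_inv_seq (f : fps) (n : nat) : seq rat :=
  if n is m.+1 then
    let s := fps_inv_seq f m in
    rcons s (((m == 0%N)%:R - \sum_(i < m) f (m - i)%N * s`_i) / f 0%N)
  else [::].

(* Meaningful only when f 0 != 0, see [fps_mulfV]. *)
Definition fps_inv (f : fps) : fps := fun n => (fps_inv_seq f n.+1)`_n.

Definition fps_div (f g : fps) : fps := fps_mul f (fps_inv g).

(* The series exp(a x). *)
Definition fps_exp (a : rat) : fps := fun n => a ^+ n / n`!%:R.

Definition egf (c : nat -> nat) : fps := fun n => (c n)%:R / n`!%:R.

Lemma size_fps_inv_seq f n : size (fps_inv_seq f n) = n.
Proof. by elim: n => //= n IHn; rewrite size_rcons IHn. Qed.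

Lemma nth_fps_inv_seq f n i : (i < n)%N -> (fps_inv_seq f n)`_i = fps_inv f i.
Proof.
elim: n => // n IHn; rewrite ltnS leq_eqVlt => /predU1P[-> // | lt_in].
by rewrite /= nth_rcons size_fps_inv_seq lt_in IHn.
Qed.

Lemma fps_mulfV (f : fps) : f 0%N != 0 -> fps_mul f (fps_inv f) =1 fps_const 1.
Proof.
move=> f0 n; rewrite /fps_mul big_ord_recl /= subn0.
rewrite {1}/fps_inv /= nth_rcons size_fps_inv_seq ltnn eqxx mulrC divfK //.
rewrite (reindex_inj rev_ord_inj) /=.
under [X in _ - X + _]eq_bigr => i _.
  rewrite nth_fps_inv_seq; last by rewrite ltn_subrL (leq_ltn_trans _ (ltn_ord i)).
  rewrite subKn //; over.
by rewrite subrK /fps_const; case: (n == 0%N).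
Qed.

(* Main.v *)
Require Import Defs.
From mathcomp Require Import all_boot all_order all_algebra.
From mathcomp Require Import ring zify.

(** A nonnesting permutation avoids 1231 and 1321 exactly when, between the two
    copies of any letter, the letters larger than it are all equal.  The words
    are built by inserting the letters in decreasing order, so that the pair of
    copies of [a] to be inserted is smaller than every letter already present.
    Then at most one letter may stand between the two copies, and no letter may
    occur on both sides of the pair ([admissible_insert]).

    Call a gap of a word a cut when no letter occurs on both sides of it; the
    cuts divide the word into components.  If nothing stands between the two
    copies of [a], the pair sits in a cut; if one letter [x] stands between
    them, then [x] is next to a cut, that is, it is the first or the last letter
    of a component ([separated_around], [mem_extensions]).  In a word with [m]
    components the first kind of insertion can be made in [m + 1] ways and
    creates a new component, the second in [2 * m] ways and keeps the number of
    components ([sum_extensions]).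

    So the exponential generating function [B_m] of the words with [m]
    components satisfies [B_m' = m B_(m-1) + 2 m B_m], whose solution is
    [B_m = B^m] with [B = (exp(2x) - 1) / 2], and the sum over [m] is
    [1 / (1 - B) = 2 / (3 - exp(2x))].  Instead of solving the equations, the
    identity [exp(2x) B_m = B_m + 2 B_(m+1)] is verified on coefficients by
    induction, in a form dual to the index [m]: the coefficients are tested
    against an arbitrary weight [h] on the number of components
    ([binomial_transform_total]).  With constant weight it becomes
    [3 C - exp(2x) C = 2] for the wanted series [C]
    ([num_avoiding_recurrence]), and such a [C] is unique ([fps_mul_inj]). *)

Set Implicit Arguments.
Unset Strict Implicit.
Unset Printing Implicit Defensive.

Local Open Scope nat_scope.

(** * Pattern containment through subsequences *)

(** The quantifiers range over explicit lists so that the relation computes on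
    words of known length. *)
Definition order_iso (s sigma : seq nat) : bool :=
  (size s == size sigma) &&
  all (fun r => all (fun t =>
      ((nth 0 s r < nth 0 s t) == (nth 0 sigma r < nth 0 sigma t)) &&
      ((nth 0 s r == nth 0 s t) == (nth 0 sigma r == nth 0 sigma t)))
    (iota 0 (size sigma))) (iota 0 (size sigma)).

(** Bridges the boolean [subseq], which works by recursion on words, and
    occurrences given by increasing positions. *)
Lemma subseq_positionsP (s w : seq nat) :
  reflect (exists2 t, sorted ltn t & all (gtn (size w)) t /\ s = map (nth 0 w) t)
          (subseq s w).
Proof.
apply: (iffP subseqP) => [[m szm ->] | [t t_sorted [t_lt ->]]].
  exists (mask m (iota 0 (size w))).
    by apply: sorted_mask (iota_ltn_sorted _ _); apply: ltn_trans.
  split; last by rewrite map_mask map_nth_iota0 // take_size.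
  by apply/allP=> i /mem_mask; rewrite mem_iota.
apply/subseqP; rewrite -{2}(take_size w) -(map_nth_iota0 0 (leqnn _)).
apply: map_subseq.
(* A strictly increasing list is determined by its elements. *)
rewrite (_ : t = [seq i <- iota 0 (size w) | i \in t]) ?filter_subseq //.
apply: (irr_sorted_eq ltn_trans ltnn t_sorted).
  by apply: sorted_filter (iota_ltn_sorted _ _); apply: ltn_trans.
move=> i; rewrite mem_filter mem_iota /= add0n andbC.
by case: (boolP (i \in t)) => [/(allP t_lt) /= -> | _]; rewrite ?andbF.
Qed.

Lemma contains_patternP (w sigma : seq nat) :
  reflect (exists2 s, subseq s w & order_iso s sigma) (contains_pattern w sigma).
Proof.
apply: (iffP existsP) => [[f f_ok] | [s /subseq_positionsP]].
  pose t := [seq (f i : nat) | i <- enum 'I_(size sigma)].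
  have f_inc (i j : 'I_(size sigma)) : i < j -> f i < f j.
    by move=> lt_ij; have /forallP/(_ j)/and3P[/implyP/(_ lt_ij)] := forallP f_ok i.
  have sz_t : size t = size sigma by rewrite size_map -cardE card_ord.
  have nth_t (i : 'I_(size sigma)) : nth 0 t i = f i.
    by rewrite (nth_map i) ?size_enum_ord // nth_ord_enum.
  exists (map (nth 0 w) t).
    apply/subseq_positionsP; exists t => //.
      apply/(sortedP 0) => i; rewrite sz_t => lt_i.
      by rewrite (nth_t (Ordinal (ltnW lt_i))) (nth_t (Ordinal lt_i)); apply: f_inc.
    by split=> //; apply/allP=> _ /mapP[i _ ->] /=.
  rewrite /order_iso size_map sz_t eqxx /=.
  apply/allP => r; rewrite mem_iota => /= lt_r.
  apply/allP => u; rewrite mem_iota => /= lt_u.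
  rewrite !(nth_map 0) ?sz_t // (nth_t (Ordinal lt_r)) (nth_t (Ordinal lt_u)).
  have /forallP/(_ (Ordinal lt_u))/and3P[_ ok1 ok2] := forallP f_ok (Ordinal lt_r).
  by rewrite ok1 ok2.
case=> t t_sorted [t_lt ->] /andP[]; rewrite size_map => /eqP sz_t iso.
have t_lt_w (i : 'I_(size sigma)) : nth 0 t i < size w.
  by apply: (allP t_lt); rewrite mem_nth ?sz_t.
exists [ffun i => Ordinal (t_lt_w i)].
apply/forallP => r; apply/forallP => u; rewrite !ffunE /=.
have lt_r := ltn_ord r; have lt_u := ltn_ord u.
apply/andP; split.
  apply/implyP => lt_ru.
  by rewrite (sorted_ltn_nth ltn_trans 0 t_sorted) ?inE ?sz_t.
have /allP/(_ r) := iso; rewrite mem_iota /= add0n => /(_ lt_r).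
by move=> /allP/(_ u); rewrite mem_iota /= add0n !(nth_map 0) ?sz_t // => /(_ lt_u).
Qed.


Lemma order_iso_size (s sigma : seq nat) :
  order_iso s sigma -> size s = size sigma.
Proof. by case/andP=> /eqP. Qed.

Lemma order_iso_1221 (a b c d : nat) :
  order_iso [:: a; b; c; d] [:: 1; 2; 2; 1] = [&& a < b, c == b & d == a].
Proof. by rewrite /order_iso /=; lia. Qed.

Lemma order_iso_2112 (a b c d : nat) :
  order_iso [:: a; b; c; d] [:: 2; 1; 1; 2] = [&& b < a, c == b & d == a].
Proof. by rewrite /order_iso /=; lia. Qed.

Lemma order_iso_1231 (a b c d : nat) :
  order_iso [:: a; b; c; d] [:: 1; 2; 3; 1] = [&& a < b, b < c & d == a].
Proof. by rewrite /order_iso /=; lia. Qed.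

Lemma order_iso_1321 (a b c d : nat) :
  order_iso [:: a; b; c; d] [:: 1; 3; 2; 1] = [&& a < c, c < b & d == a].
Proof. by rewrite /order_iso /=; lia. Qed.

Lemma avoids4P (w : seq nat) (p q r t : nat) :
  reflect (forall a b c d, order_iso [:: a; b; c; d] [:: p; q; r; t] ->
             ~~ subseq [:: a; b; c; d] w)
          (avoids w [:: p; q; r; t]).
Proof.
apply: (iffP idP) => [/contains_patternP w_av a b c d iso | w_av].
  by apply/negP=> sub; apply: w_av; exists [:: a; b; c; d].
apply/contains_patternP => -[s sub iso]; have := order_iso_size iso.
move: s sub iso => [|a [|b [|c [|d []]]]] //= sub /w_av.
by rewrite sub.
Qed.

Definition nonnesting (w : seq nat) : Prop :=
  forall a b, a != b -> ~~ subseq [:: a; b; b; a] w.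

(** Avoidance of 1231 and of 1321 at once: [b] and [c] come in either order. *)
Definition narrow (w : seq nat) : Prop :=
  forall a b c, a < b -> a < c -> b != c -> ~~ subseq [:: a; b; c; a] w.

Definition admissible (w : seq nat) : Prop := nonnesting w /\ narrow w.

Lemma admissibleP (w : seq nat) :
  reflect (admissible w)
    ((avoids w [:: 1; 2; 2; 1] && avoids w [:: 2; 1; 1; 2]) &&
     all (avoids w) [:: [:: 1; 2; 3; 1]; [:: 1; 3; 2; 1]]).
Proof.
rewrite /= andbT; apply: (iffP idP).
  case/andP=> /andP[/avoids4P w1 /avoids4P w2] /andP[/avoids4P w3 /avoids4P w4].
  split=> [a b | a b c lt_ab lt_ac]; rewrite neq_ltn => /orP[] lt.
  - by apply: w1; rewrite order_iso_1221 lt !eqxx.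
  - by apply: w2; rewrite order_iso_2112 lt !eqxx.
  - by apply: w3; rewrite order_iso_1231 lt_ab lt eqxx.
  - by apply: w4; rewrite order_iso_1321 lt_ac lt eqxx.
case=> w_nn w_na; apply/andP; split; apply/andP; split; apply/avoids4P => a b c d.
- rewrite order_iso_1221 => /and3P[lt /eqP-> /eqP->]; apply: w_nn.
  by rewrite neq_ltn lt.
- rewrite order_iso_2112 => /and3P[lt /eqP-> /eqP->]; apply: w_nn.
  by rewrite neq_ltn lt orbT.
- rewrite order_iso_1231 => /and3P[lt1 lt2 /eqP->]; apply: w_na => //.
    exact: ltn_trans lt2.
  by rewrite neq_ltn lt2.
rewrite order_iso_1321 => /and3P[lt1 lt2 /eqP->]; apply: w_na => //.
  exact: ltn_trans lt2.
by rewrite neq_ltn lt2 orbT.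
Qed.

(** * Inserting the smallest letter *)

(** Both words contain the same number of copies of [a], so an embedding sends
    the first copy to the first copy, and therefore splits there. *)
Lemma subseq_cat_cons (T : eqType) (a : T) (s1 s2 P R : seq T) :
  a \notin s1 -> a \notin P -> count_mem a s2 = count_mem a R ->
  subseq (s1 ++ a :: s2) (P ++ a :: R) = subseq s1 P && subseq s2 R.
Proof.
move=> a_s1 a_P eq_a; apply/idP/andP; last first.
  by case=> sub1 sub2; apply: cat_subseq; rewrite //= eqxx.
elim: P s1 a_P a_s1 => [|p P IHP] [|x s1] /=.
- by rewrite eqxx.
- rewrite inE negb_or => _ /andP[/negbTE a_x _]; rewrite eq_sym a_x.
  by move=> /(leq_count_subseq (pred1 a)); rewrite /= count_cat /= eqxx; lia.
- rewrite inE negb_or => /andP[/negbTE -> a_P] _ sub.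
  by have [] := IHP [::] a_P isT sub.
- rewrite !inE !negb_or => /andP[_ a_P] /andP[a_x a_s1].
  case: eqP => [_ | _] sub; first exact: IHP.
  by have [] := IHP (x :: s1) a_P; rewrite ?inE ?negb_or ?a_x.
Qed.

Definition separated (P Q : seq nat) : bool := ~~ has (mem Q) P.

Lemma admissible_subseq (v w : seq nat) :
  subseq v w -> admissible w -> admissible v.
Proof.
move=> sub_vw [w_nn w_na]; split=> [a b ab | a b c ab ac bc].
  by apply: contra (w_nn a b ab) => /subseq_trans; apply.
by apply: contra (w_na a b c ab ac bc) => /subseq_trans; apply.
Qed.

Lemma filter_predC1_id (a : nat) (w : seq nat) :
  a \notin w -> filter (predC1 a) w = w.
Proof.
move=> a_w; apply/all_filterP/allP => x x_w /=.
by apply: contraNneq a_w => <-.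
Qed.

Lemma filter_insert (a : nat) (P M Q : seq nat) :
  a \notin P ++ M ++ Q ->
  filter (predC1 a) (P ++ a :: M ++ a :: Q) = P ++ M ++ Q.
Proof.
rewrite !mem_cat !negb_or => /and3P[aP aM aQ].
by rewrite filter_cat /= eqxx filter_cat /= eqxx /= !filter_predC1_id.
Qed.

(** A forbidden subsequence that uses [a] can only have [a] as its smallest
    letter.  In the form [a b b a] or [a b c a] it amounts to two letters of
    [M]; in the form [x a a x] it amounts to a letter [x] common to [P] and
    [Q]. *)
Lemma admissible_insert (a : nat) (P M Q : seq nat) :
  all (ltn a) (P ++ M ++ Q) ->
  admissible (P ++ a :: M ++ a :: Q) <->
  [/\ admissible (P ++ M ++ Q), size M <= 1 & separated P Q].
Proof.
move=> lt_a; have a_w : a \notin P ++ M ++ Q.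
  by apply/negP => /(allP lt_a); rewrite /= ltnn.
have fil := filter_insert a_w.
move: (a_w); rewrite !mem_cat !negb_or => /and3P[aP aM aQ].
have cP := count_memPn aP; have cM := count_memPn aM; have cQ := count_memPn aQ.
have sub_in s : a \notin s ->
    subseq (a :: s ++ [:: a]) (P ++ a :: M ++ a :: Q) = subseq s M.
  move=> a_s; rewrite (subseq_cat_cons (s1 := [::])) //=; last first.
    by rewrite !count_cat /= cM cQ (count_memPn a_s).
  by rewrite subseq_cat_cons ?sub0seq ?andbT //= cQ.
have sub_out x : x != a ->
    subseq [:: x; a; a; x] (P ++ a :: M ++ a :: Q) = (x \in P) && (x \in Q).
  move=> xa; have ax : a \notin [:: x] by rewrite inE eq_sym.
  rewrite (subseq_cat_cons (s1 := [:: x])) //=; last first.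
    by rewrite !count_cat /= cM cQ eqxx (negbTE xa).
  rewrite (subseq_cat_cons (s1 := [::])) //=; last first.
    by rewrite cQ (negbTE xa).
  by rewrite sub0seq !sub1seq.
split=> [w_adm | [[w_nn w_na] M1 PQ]].
  case: (w_adm) => w_nn w_na; split.
  - by apply: admissible_subseq w_adm; rewrite -fil filter_subseq.
  - move: lt_a sub_in => {fil sub_out}; case: M {aM cM w_adm a_w} w_nn w_na.
      by [].
    move=> b [//|c M] w_nn w_na lt_a sub_in.
    have lt_ab : a < b by apply: (allP lt_a); rewrite !mem_cat inE eqxx ?orbT.
    have lt_ac : a < c by apply: (allP lt_a); rewrite !mem_cat !inE eqxx ?orbT.
    have sub_bc : subseq [:: a; b; c; a] (P ++ a :: (b :: c :: M) ++ a :: Q).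
      rewrite (sub_in [:: b; c]) /= ?eqxx ?sub0seq // !inE negb_or.
      by rewrite !neq_ltn lt_ab lt_ac.
    have [eq_bc | bc] := eqVneq b c.
      by have /negP[] := w_nn a c (negbT (ltn_eqF lt_ac)); rewrite -{1}eq_bc.
    by have /negP[] := w_na a b c lt_ab lt_ac bc.
  - apply/hasPn => x xP; apply/negP => /= xQ.
    have xa : x != a by apply: contraNneq aP => <-.
    by have /negP[] := w_nn x a xa; rewrite sub_out // xP.
have sub_fil s : a \notin s ->
    subseq s (P ++ a :: M ++ a :: Q) -> subseq s (P ++ M ++ Q).
  move=> a_s sub; rewrite -fil subseq_filter sub andbT.
  by apply/allP => x x_s; apply: contraNneq a_s => <-.
split=> [x y xy | x y z xy xz yz]; apply/negP => sub.
  have [ex | xa] := eqVneq x a.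
    have ya : y != a by rewrite eq_sym -ex.
    move: sub; rewrite ex (sub_in [:: y; y]) => [/size_subseq /=|]; first by lia.
    by rewrite !inE orbb eq_sym.
  have [ey | ya] := eqVneq y a.
    move: sub; rewrite ey sub_out // => /andP[xP xQ].
    by move/hasPn: PQ => /(_ x xP) /=; rewrite xQ.
  have /negP[] := w_nn x y xy; apply: sub_fil => //.
  by rewrite !inE !negb_or !(eq_sym a) xa ya.
have /orP[/eqP ex | lt_ax] : (x == a) || (a < x).
  have : x \in P ++ a :: M ++ a :: Q by rewrite (mem_subseq sub) ?inE ?eqxx.
  rewrite !mem_cat !inE => x_w; apply/orP.
  have [_|xa] := eqVneq x a; [by left | right].
  apply: (allP lt_a); move: x_w; rewrite (negbTE xa) !mem_cat.
  by rewrite !inE (negbTE xa).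
  move: sub; rewrite ex (sub_in [:: y; z]) => [/size_subseq /=|]; first by lia.
  by rewrite !inE -ex negb_or !neq_ltn xy xz.
have /negP[] := w_na x y z xy xz yz; apply: sub_fil => //.
by rewrite !inE !negb_or !neq_ltn lt_ax (ltn_trans lt_ax xy) (ltn_trans lt_ax xz).
Qed.

(** One copy of [a] goes into gap [i], the other into gap [i + k]. *)
Definition insert_around (a i k : nat) (w : seq nat) : seq nat :=
  take i w ++ a :: take k (drop i w) ++ a :: drop (i + k) w.

Lemma insert_around_cat (a : nat) (P M Q : seq nat) :
  insert_around a (size P) (size M) (P ++ M ++ Q) = P ++ a :: M ++ a :: Q.
Proof.
rewrite /insert_around take_size_cat // drop_size_cat // take_size_cat //.
by rewrite addnC -drop_drop !drop_size_cat.
Qed.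

Lemma cat_take_drop2 (i k : nat) (w : seq nat) :
  take i w ++ take k (drop i w) ++ drop (i + k) w = w.
Proof. by rewrite addnC -drop_drop !cat_take_drop. Qed.

Lemma two_occurrences (a : nat) (v : seq nat) :
  count_mem a v = 2 ->
  exists P M Q, v = P ++ a :: M ++ a :: Q /\ a \notin P ++ M ++ Q.
Proof.
move=> v2; have : a \in v by rewrite -has_pred1 has_count v2.
move=> a_v; move: v2; case/splitPr: a_v => P R; rewrite count_cat /= eqxx /= => PR1.
have [/splitPr a_P | aP] := boolP (a \in P).
  case: a_P PR1 => P1 P2; rewrite count_cat /= eqxx /= => PR1.
  exists P1, P2, R; rewrite -catA; split=> //.
  by apply/count_memPn; rewrite !count_cat /=; lia.
have /splitPr a_R : a \in R.
  by rewrite -has_pred1 has_count; move: PR1; rewrite (count_memPn aP) /=; lia.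
case: a_R PR1 => M Q; rewrite count_cat /= eqxx /= => PR1.
by exists P, M, Q; split=> //; apply/count_memPn; rewrite !count_cat /=; lia.
Qed.

(** * Cuts and components *)

Definition is_cut (w : seq nat) (i : nat) : bool :=
  separated (take i w) (drop i w).

(** A component is counted by the cut at its end, whence the start at 1. *)
Definition components (w : seq nat) : nat :=
  count (is_cut w) (iota 1 (size w)).

Definition twofold (w : seq nat) : Prop := forall x, x \in w -> count_mem x w = 2.

Lemma is_cut0 (w : seq nat) : is_cut w 0.
Proof. by rewrite /is_cut take0. Qed.

Lemma is_cut_size (w : seq nat) : is_cut w (size w).
Proof. by rewrite /is_cut take_size drop_size /separated -all_predC; apply/allP. Qed.

Lemma separated_sym (P Q : seq nat) : separated P Q = separated Q P.
Proof. by rewrite /separated has_sym. Qed.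

Lemma separated_cons (x : nat) (P Q : seq nat) :
  separated P (x :: Q) = (x \notin P) && separated P Q.
Proof.
by rewrite separated_sym /separated /= negb_or -!/(separated _ _) separated_sym.
Qed.

Lemma separated_cat (P Q R : seq nat) :
  separated P (Q ++ R) = separated P Q && separated P R.
Proof. by rewrite !(separated_sym P) /separated has_cat negb_or. Qed.

Lemma is_cut_cat (P Q : seq nat) : is_cut (P ++ Q) (size P) = separated P Q.
Proof. by rewrite /is_cut take_size_cat ?drop_size_cat. Qed.

Lemma is_cut_letter (P Q : seq nat) (x : nat) (w := P ++ x :: Q) :
  (is_cut w (size P) = (x \notin P) && separated P Q) *
  (is_cut w (size P).+1 = (x \notin Q) && separated P Q).
Proof.
split; first by rewrite is_cut_cat separated_cons.
rewrite /w -cat_rcons -(size_rcons P x) is_cut_cat -cats1.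
by rewrite /separated has_cat /= orbF negb_or andbC.
Qed.

(** The letter between two consecutive cuts would have no second copy. *)
Lemma not_both_cuts (w : seq nat) (i : nat) :
  twofold w -> i < size w -> is_cut w i && is_cut w i.+1 = false.
Proof.
move=> w2 lt_i; have defw := cat_take_drop i w.
have szP := size_takel (ltnW lt_i).
case: (drop i w) defw => [|x Q] defw.
  by have := congr1 size defw; rewrite cats0 szP => eq_i; rewrite -eq_i ltnn in lt_i.
have [cut1 cut2] := is_cut_letter (take i w) Q x.
rewrite defw szP in cut1 cut2; rewrite cut1 cut2.
apply/negP => /andP[/andP[xP _] /andP[xQ _]].
have := w2 x; rewrite -defw mem_cat inE eqxx orbT => /(_ isT).
by rewrite count_cat /= eqxx (count_memPn xP) (count_memPn xQ).
Qed.

(** The second copy of [x] lies in [P] or in [Q], not in both; joining the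
    displayed [x] to that side keeps the two sides disjoint. *)
Lemma separated_around (P Q : seq nat) (x : nat) (w := P ++ x :: Q) :
  twofold w -> separated P Q = is_cut w (size P) || is_cut w (size P).+1.
Proof.
move=> w2; rewrite !is_cut_letter -andb_orl.
case: (boolP (x \in P)) => //= xP; case: (boolP (x \in Q)) => //= xQ.
have := w2 x; rewrite mem_cat xP => /(_ isT); rewrite count_cat /= eqxx.
move: xP xQ; rewrite -!has_pred1 !has_count /=; lia.
Qed.

(** Gaps [0] and [size w] are both cuts; a component has a cut at either end,
    so leaving out one of these two gaps leaves one cut for each component. *)
Lemma count_cuts (w : seq nat) :
  (count (is_cut w) (iota 0 (size w).+1) = (components w).+1) *
  (count (is_cut w) (iota 0 (size w)) = components w) *
  (count (fun i => is_cut w i.+1) (iota 0 (size w)) = components w).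
Proof.
have cnt0 : count (is_cut w) (iota 0 (size w).+1) = (components w).+1.
  by rewrite /= is_cut0.
split; [split=> // | ].
  by move: cnt0; rewrite -[(size w).+1]addn1 iotaD count_cat add0n /= is_cut_size; lia.
by rewrite /components (iotaDl 1 0) count_map.
Qed.

Lemma is_cut_prefix (P R : seq nat) (i : nat) :
  i <= size P -> is_cut (P ++ R) i = separated (take i P) (drop i P ++ R).
Proof.
move=> le_i; have := is_cut_cat (take i P) (drop i P ++ R).
by rewrite catA cat_take_drop size_takel.
Qed.

Lemma is_cut_suffix (L Q : seq nat) (j : nat) :
  j <= size Q ->
  is_cut (L ++ Q) (size L + j) = separated (L ++ take j Q) (drop j Q).
Proof.
move=> le_j; have := is_cut_cat (L ++ take j Q) (drop j Q).
by rewrite -catA cat_take_drop size_cat size_takel.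
Qed.

(** No gap between the copies of [a] is a cut, and outside of them a gap is a
    cut exactly when it was one before.  When [M] is empty the gap where the
    pair is inserted occurs in both counts, as it gives rise to two gaps. *)
Lemma count_cuts_insert (a : nat) (P M Q : seq nat) (w := P ++ M ++ Q) :
  a \notin w ->
  (components (P ++ a :: M ++ a :: Q)).+1 =
  count (is_cut w) (iota 0 (size P).+1) +
  count (is_cut w) (iota (size P + size M) (size Q).+1).
Proof.
rewrite !mem_cat !negb_or => /and3P[aP aM aQ]; set v := P ++ _.
have szv : (size v).+1 = (size P).+1 + ((size M).+1 + (size Q).+1).
  by rewrite /v size_cat /= size_cat /=; lia.
(* The gaps before the pair, inside it, and after it are treated in turn. *)
rewrite -count_cuts szv !iotaD !count_cat; congr (_ + _).
  apply: eq_in_count => i; rewrite mem_iota ltnS => /= le_i.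
  have a_i : a \notin take i P by apply: contra aP; apply: mem_take.
  by rewrite !is_cut_prefix // !(separated_cat, separated_cons) a_i.
rewrite -[X in _ = X]add0n; congr (_ + _).
  apply/eqP; rewrite -leqn0 leqNgt -has_count -all_predC.
  rewrite add0n -[X in iota X]addn0 iotaDl all_map.
  apply/allP => j; rewrite mem_iota ltnS => /= le_j.
  have := @is_cut_suffix (rcons P a) (M ++ a :: Q) j.
  rewrite cat_rcons size_rcons size_cat /= => ->; last by lia.
  have a_P : a \in rcons P a ++ take j (M ++ a :: Q).
    by rewrite mem_cat mem_rcons inE eqxx.
  have a_Q : a \in drop j (M ++ a :: Q).
    rewrite drop_cat; case: ltnP => [_ | ge_j].
      by rewrite mem_cat mem_head orbT.
    by rewrite (_ : j - size M = 0) ?mem_head //; apply/eqP; rewrite subn_eq0.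
  by rewrite negbK; apply/hasP; exists a.
have shift m n : iota m n = map (addn m) (iota 0 n) by rewrite -iotaDl addn0.
rewrite shift [in RHS]shift !count_map.
apply: eq_in_count => j; rewrite mem_iota ltnS => /= le_j.
have := is_cut_suffix (P ++ M) le_j.
have := is_cut_suffix (rcons (P ++ a :: M) a) le_j.
rewrite cat_rcons -!catA /= size_rcons !size_cat /= -/v -/w => cut_v ->.
rewrite (_ : 0 + _ + _ + j = (size P + (size M).+1).+1 + j) ?cut_v; last by lia.
have a_j : a \notin drop j Q by apply: contra aQ; apply: mem_drop.
by rewrite cat_rcons !(separated_sym _ (drop j Q)) !(separated_cat, separated_cons) a_j -andbA.
Qed.

(** * Extensions of a word by a smaller letter *)

(** In the second list the letter at position [i], between gaps [i] and
    [i + 1], is enclosed. *)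
Definition extensions (a : nat) (w : seq nat) : seq (seq nat) :=
  [seq insert_around a i 0 w | i <- iota 0 (size w).+1 & is_cut w i] ++
  [seq insert_around a i 1 w | i <- iota 0 (size w) & is_cut w i || is_cut w i.+1].

(** Deleting [a] is a map from admissible words to admissible words, and the
    extensions of [w] form its fibre above [w]: by [admissible_insert] at most
    one letter is enclosed, and [separated_around] says where that is allowed. *)
Lemma mem_extensions (a : nat) (w v : seq nat) :
  all (ltn a) w -> twofold w -> admissible w ->
  v \in extensions a w <->
  [/\ filter (predC1 a) v = w, count_mem a v = 2 & admissible v].
Proof.
move=> lt_a w2 w_adm; have a_w : a \notin w.
  by apply/negP => /(allP lt_a); rewrite /= ltnn.
have ext_ok P M Q : w = P ++ M ++ Q -> size M <= 1 -> separated P Q ->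
    [/\ filter (predC1 a) (P ++ a :: M ++ a :: Q) = w,
        count_mem a (P ++ a :: M ++ a :: Q) = 2
      & admissible (P ++ a :: M ++ a :: Q)].
  move=> defw M1 PQ; rewrite defw in lt_a w_adm a_w *; split.
  - exact: filter_insert.
  - move/count_memPn: a_w; rewrite !count_cat /= !count_cat /= eqxx; lia.
  - exact/admissible_insert.
split.
  rewrite mem_cat => /orP[] /mapP[i]; rewrite mem_filter mem_iota add0n /=.
    move=> /andP[cut_i _] ->; apply: ext_ok => //.
      exact/esym/cat_take_drop2.
      by rewrite take0.
    by rewrite addn0.
  move=> /andP[cut_i lt_i] ->; apply: ext_ok; first exact/esym/cat_take_drop2.
    by rewrite size_take_min geq_minl.
  have szP := size_takel (ltnW lt_i).
  rewrite (separated_around (x := nth 0 w i)).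
    by rewrite addn1 -drop_nth // cat_take_drop szP.
  by rewrite addn1 -drop_nth // cat_take_drop.
case=> defw v2 v_adm; have [P [M [Q [defv aPMQ]]]] := two_occurrences v2.
move: defw v_adm; rewrite defv filter_insert // => defw.
rewrite admissible_insert ?defw // => -[_ M1 PQ].
rewrite mem_cat -insert_around_cat defw.
case: M M1 defw {defv aPMQ} => [|x [|//]] _ defw; apply/orP; [left | right].
  apply/mapP; exists (size P) => //;
    rewrite mem_filter mem_iota -defw is_cut_cat PQ size_cat; lia.
apply/mapP; exists (size P) => //;
  rewrite mem_filter mem_iota -defw -separated_around ?defw // PQ.
by rewrite -defw size_cat /=; lia.
Qed.

Lemma components_insert0 (a i : nat) (w : seq nat) :
  a \notin w -> i <= size w -> is_cut w i ->
  components (insert_around a i 0 w) = (components w).+1.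
Proof.
move=> a_w le_i cut_i; apply: succn_inj.
have := @count_cuts_insert a (take i w) [::] (drop i w).
rewrite !cat0s cat_take_drop => /(_ a_w).
rewrite /insert_around take0 !addn0 cat0s size_takel // size_drop => ->.
rewrite -count_cuts (_ : (size w).+1 = i.+1 + (size w - i)); last by lia.
by rewrite iotaD count_cat add0n /= cut_i; lia.
Qed.

Lemma components_insert1 (a i : nat) (w : seq nat) :
  a \notin w -> i < size w ->
  components (insert_around a i 1 w) = components w.
Proof.
move=> a_w lt_i; apply: succn_inj.
have := @count_cuts_insert a (take i w) (take 1 (drop i w)) (drop (i + 1) w).
rewrite cat_take_drop2 => /(_ a_w) ->.
rewrite !size_takel ?size_drop ?subn_gt0 // 1?ltnW // -count_cuts.
rewrite (_ : (size w).+1 = i.+1 + (size w - (i + 1)).+1); last by lia.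
by rewrite iotaD count_cat add0n addn1.
Qed.

Lemma sum_eq_const (T : eqType) (r : seq T) (p : pred T) (F : T -> nat) (c : nat) :
  {in r, forall i, p i -> F i = c} -> \sum_(i <- r | p i) F i = count p r * c.
Proof.
move=> Fc; rewrite big_seq_cond (eq_bigr (fun=> c)) => [|i /andP[]]; last exact: Fc.
by rewrite -big_seq_cond big_const_seq iter_addn_0 mulnC.
Qed.

(** Each of the [m + 1] cuts takes a pair [a a].  The positions next to a cut
    are the first and the last position of each of the [m] components, and
    these differ because every letter occurs twice; a pair can enclose any one
    of these [2 * m] positions. *)
Lemma sum_extensions (a : nat) (w : seq nat) (h : nat -> nat) :
  a \notin w -> twofold w ->
  \sum_(v <- extensions a w) h (components v) =
  (components w).+1 * h (components w).+1 + 2 * components w * h (components w).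
Proof.
move=> a_w w2; rewrite big_cat !big_map !big_filter; congr (_ + _).
  rewrite -{1}count_cuts; apply: sum_eq_const => i; rewrite mem_iota ltnS => le_i cut_i.
  by rewrite components_insert0.
rewrite (sum_eq_const (c := h (components w))) => [|i]; last first.
  by rewrite mem_iota => /= lt_i _; rewrite components_insert1.
congr (_ * _); have := count_predUI (is_cut w) (fun i => is_cut w i.+1) (iota 0 (size w)).
rewrite !count_cuts addnn mul2n => <-; rewrite -[LHS]addn0; congr (_ + _).
apply/esym/eqP; rewrite -leqn0 leqNgt -has_count; apply/hasPn => i.
by rewrite mem_iota => /= lt_i; rewrite not_both_cuts.
Qed.

(** The position of the first [a] tells the gap, and the number of components
    tells which of the two lists the word comes from. *)
Lemma uniq_extensions (a : nat) (w : seq nat) :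
  a \notin w -> uniq (extensions a w).
Proof.
move=> a_w; have index_insert k i : i <= size w -> index a (insert_around a i k w) = i.
  move=> le_i; rewrite /insert_around index_cat ifN; last first.
    by apply: contra a_w; apply: mem_take.
  by rewrite /= eqxx addn0 size_takel.
rewrite cat_uniq; apply/and3P; split.
- rewrite map_inj_in_uniq ?filter_uniq ?iota_uniq // => i j.
  rewrite !mem_filter !mem_iota => /andP[_ /= le_i] /andP[_ /= le_j].
  by move/(congr1 (index a)); rewrite !index_insert.
- apply/hasPn => v /mapP[i]; rewrite mem_filter mem_iota add0n => /andP[_ /andP[_ lt_i]] ->.
  apply/negP => /mapP[j]; rewrite mem_filter mem_iota => /andP[cut_j /= le_j] eq_v.
  have := congr1 components eq_v; rewrite components_insert1 ?components_insert0 //.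
  by move/eqP; rewrite -[_ == _.+1]negbK neq_ltn ltnSn.
rewrite map_inj_in_uniq ?filter_uniq ?iota_uniq // => i j.
rewrite !mem_filter !mem_iota => /andP[_ /= lt_i] /andP[_ /= lt_j].
by move/(congr1 (index a)); rewrite !index_insert // ltnW.
Qed.

(** * Generating all admissible words *)

(** The alphabet is [a, ..., a + n - 1]; letting it start at an arbitrary [a]
    allows a smallest letter to be added without renaming the others. *)
Fixpoint words (a n : nat) : seq (seq nat) :=
  if n is n'.+1 then [seq v | w <- words a.+1 n', v <- extensions a w]
  else [:: [::]].

Lemma perm_insert_letter (a n : nat) (v : seq nat) :
  perm_eq v (iota a n.+1 ++ iota a n.+1) <->
  count_mem a v = 2 /\ perm_eq (filter (predC1 a) v) (iota a.+1 n ++ iota a.+1 n).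
Proof.
have a_iota : a \notin iota a.+1 n by rewrite mem_iota ltnn.
split=> [perm_v | [v2 perm_v]].
  split; first by rewrite (permP perm_v) count_cat /= eqxx !(count_memPn a_iota).
  have := @filter_insert a [::] (iota a.+1 n) (iota a.+1 n).
  rewrite !cat0s mem_cat orbb => <- //; exact: perm_filter perm_v.
have perm_aa : perm_eq v (a :: a :: filter (predC1 a) v).
  rewrite -(perm_filterC (pred1 a)) (all_pred1P _ _ (filter_all (pred1 a) v)).
  by rewrite size_filter v2.
apply: (perm_trans perm_aa); rewrite /= perm_cons perm_sym.
by rewrite -[a :: iota a.+1 n]cat1s perm_catCA cat1s perm_cons perm_sym.
Qed.

Lemma perm_twofold (a n : nat) (w : seq nat) :
  perm_eq w (iota a n ++ iota a n) -> twofold w.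
Proof.
move=> perm_w x; rewrite (perm_mem perm_w) (permP perm_w) mem_cat orbb => x_in.
by rewrite count_cat count_uniq_mem ?iota_uniq ?x_in.
Qed.

Lemma perm_lower_bound (a n : nat) (w : seq nat) :
  perm_eq w (iota a.+1 n ++ iota a.+1 n) -> all (ltn a) w.
Proof.
move=> perm_w; apply/allP => x; rewrite (perm_mem perm_w) mem_cat orbb mem_iota.
by case/andP.
Qed.

Lemma perm_notin (a n : nat) (w : seq nat) :
  perm_eq w (iota a.+1 n ++ iota a.+1 n) -> a \notin w.
Proof.
by move=> /perm_lower_bound w_gt; apply/negP => /(allP w_gt); rewrite /= ltnn.
Qed.

Lemma mem_words (a n : nat) (w : seq nat) :
  w \in words a n <-> perm_eq w (iota a n ++ iota a n) /\ admissible w.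
Proof.
elim: n a w => [|n IHn] a v.
  rewrite inE; split=> [/eqP-> | [/perm_size/size0nil-> //]].
  by split=> //; split.
rewrite perm_insert_letter; split=> [/allpairsPdep[w [u [w_in u_in ->]]] | ].
  have [perm_w w_adm] := (IHn _ _).1 w_in; move: u_in.
  by case/(mem_extensions _ (perm_lower_bound perm_w) (perm_twofold perm_w) w_adm) => ->.
case=> -[v2 perm_w] v_adm; apply/allpairsPdep.
have w_adm := admissible_subseq (filter_subseq (predC1 a) v) v_adm.
exists (filter (predC1 a) v), v; split=> //; first exact/IHn.
exact/(mem_extensions _ (perm_lower_bound perm_w) (perm_twofold perm_w) w_adm).
Qed.

Lemma uniq_words (a n : nat) : uniq (words a n).
Proof.
elim: n a => [|n IHn] a //=; apply: allpairs_uniq_dep => //.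
  move=> w /mem_words[perm_w _]; exact: uniq_extensions (perm_notin perm_w).
move=> _ _ /allpairsPdep[w [v [w_in v_in ->]]] /allpairsPdep[w' [v' [w'_in v'_in ->]]].
move=> /= eq_v; rewrite -{}eq_v {v'} in v'_in *.
have fil u : u \in words a.+1 n -> v \in extensions a u -> filter (predC1 a) v = u.
  move=> /mem_words[perm_u u_adm].
  by case/(mem_extensions _ (perm_lower_bound perm_u) (perm_twofold perm_u) u_adm).
by rewrite -(fil w) // -(fil w') // (fil w).
Qed.

Lemma num_avoiding_words (n : nat) :
  num_avoiding [:: [:: 1; 2; 3; 1]; [:: 1; 3; 2; 1]] n = size (words 1 n).
Proof.
apply: perm_size; apply: uniq_perm; rewrite ?filter_uniq ?permutations_uniq ?uniq_words //.
move=> w; rewrite mem_filter mem_filter mem_permutations andbA [all _ _ && _]andbC.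
apply/idP/idP => [/andP[/admissibleP w_adm perm_w] | /mem_words[perm_w w_adm]].
  exact/mem_words.
by apply/andP; split; first exact/admissibleP.
Qed.

(** * Weighted counts and the recurrence *)

(** If [h] weights a word by its number of components, [step h] is the total
    weight of the extensions of a word with [m] components. *)
Definition step (h : nat -> nat) (m : nat) : nat := m.+1 * h m.+1 + 2 * m * h m.

(** The total weight of the admissible words on [n] letters: they all arise
    from the empty word, which has no component, by [n] insertions. *)
Definition total (n : nat) (h : nat -> nat) : nat := iter n step h 0.

Lemma sum_words (a n : nat) (h : nat -> nat) :
  \sum_(w <- words a n) h (components w) = total n h.
Proof.
elim: n a h => [|n IHn] a h; first by rewrite big_seq1.
rewrite /total iterSr -/(total n _) -(IHn a.+1) big_allpairs_dep.
apply: eq_big_seq => w /mem_words[perm_w _].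
exact: sum_extensions (perm_notin perm_w) (perm_twofold perm_w).
Qed.

Lemma totalS (n : nat) (h : nat -> nat) : total n.+1 h = total n (step h).
Proof. by rewrite /total iterSr. Qed.

Lemma total_linear (n c : nat) (f g h : nat -> nat) :
  (forall m, h m = f m + c * g m) -> total n h = total n f + c * total n g.
Proof.
elim: n f g h => [|n IHn] f g h defh; first exact: defh.
by rewrite !totalS; apply: IHn => m; rewrite /step !defh; ring.
Qed.

(** The product with [exp(2x)], on the coefficients of exponential generating
    functions. *)
Definition binomial_transform (f : nat -> nat) (n : nat) : nat :=
  \sum_(k < n.+1) 'C(n, k) * 2 ^ k * f (n - k).

(** The Leibniz rule for the derivative of [exp(2x) F(x)]; by Pascal's rule. *)
Lemma binomial_transformS (f : nat -> nat) (n : nat) :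
  binomial_transform f n.+1 =
  2 * binomial_transform f n + binomial_transform (f \o succn) n.
Proof.
have -> : binomial_transform (f \o succn) n =
    \sum_(k < n.+2) 'C(n, k) * 2 ^ k * f (n.+1 - k).
  rewrite big_ord_recr /= bin_small // addn0; apply: eq_bigr => k _ /=.
  by rewrite subSn // -ltnS.
rewrite /binomial_transform [LHS]big_ord_recl [X in _ = _ + X]big_ord_recl !bin0.
rewrite addnCA; congr (_ + _).
rewrite big_distrr -big_split; apply: eq_bigr => k _ /=.
by rewrite /bump leq0n add1n binS subSS expnS; ring.
Qed.

(** Let [B_m] be the series of the words with [m] components.  Because
    [exp(2x) B_m = B_m + 2 B_(m+1)], multiplying the sum of the [h m * B_m] by
    [exp(2x)] adds [2 * h (m - 1)] to the coefficient of [B_m]. *)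
Definition times_exp2 (h : nat -> nat) (m : nat) : nat :=
  h m + 2 * (if m is p.+1 then h p else 0).

(** By induction through the Leibniz rule.  The inductive step is the identity
    [step (times_exp2 h) = 2 * times_exp2 h + times_exp2 (step h)], which says
    that [step], playing the role of [d/dx], satisfies the Leibniz rule for the
    product with [exp(2x)]. *)
Lemma binomial_transform_total (n : nat) (h : nat -> nat) :
  binomial_transform (total^~ h) n = total n (times_exp2 h).
Proof.
elim: n h => [|n IHn] h.
  by rewrite /binomial_transform big_ord1 /total /times_exp2 /= mul1n addn0.
rewrite binomial_transformS IHn totalS.
have -> : binomial_transform (total^~ h \o succn) n = total n (times_exp2 (step h)).
  by rewrite -IHn; apply: eq_bigr => k _; rewrite /= totalS.
rewrite addnC -(@total_linear n 2 _ _ (step (times_exp2 h))) // => -[|m];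
  rewrite /times_exp2 /step; ring.
Qed.

Lemma total_eq0 (n : nat) (h : nat -> nat) : h =1 (fun=> 0) -> total n h = 0.
Proof.
elim: n h => [|n IHn] h h0; first exact: h0.
by rewrite totalS; apply: IHn => m; rewrite /step !h0 !muln0.
Qed.

(** Only the empty word has no component. *)
Lemma total_at0 (n : nat) : total n (fun m => nat_of_bool (m == 0)) = (n == 0).
Proof.
case: n => [|n] //; rewrite totalS total_eq0 // => -[|m].
  by rewrite /step /= muln0.
by rewrite /step /= !muln0.
Qed.

(** The weight 1 is sent by [times_exp2] to 3, except at 0: the empty word is
    the only one counted once instead of three times. *)
Lemma num_avoiding_recurrence (n : nat)
    (c := num_avoiding [:: [:: 1; 2; 3; 1]; [:: 1; 3; 2; 1]]) :
  binomial_transform c n + 2 * (n == 0) = 3 * c n.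
Proof.
have defc k : c k = total k (fun=> 1).
  by rewrite /c num_avoiding_words -(sum_words 1) sum1_size.
rewrite defc -total_at0.
have -> : binomial_transform c n = total n (times_exp2 (fun=> 1)).
  by rewrite -binomial_transform_total; apply: eq_bigr => k _; rewrite defc.
rewrite -(@total_linear n 2 _ _ (fun=> 3)) => [|[|m]] //.
by rewrite (@total_linear n 2 (fun=> 1) (fun=> 1)) //; ring.
Qed.

(** * Formal power series *)

Local Open Scope ring_scope.
Import GRing.Theory Num.Theory.

(** A series with invertible constant term is not a zero divisor: comparing
    coefficients determines the other factor one index at a time. *)
Lemma fps_mul_inj (f g h : fps) :
  f 0%N != 0 -> fps_mul f g =1 fps_mul f h -> g =1 h.
Proof.
move=> f0 eq_fgh n; elim/ltn_ind: n => n IHn.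
have := eq_fgh n; rewrite /fps_mul !big_ord_recl !subn0.
rewrite (eq_bigr (fun i : 'I_n => f (lift ord0 i) * h (n - lift ord0 i)%N)).
  by move/addIr/(mulfI f0).
move=> i _; rewrite IHn // lift0; have := ltn_ord i; lia.
Qed.

Lemma fps_mul_const (a : rat) (f : fps) (n : nat) :
  fps_mul (fps_const a) f n = a * f n.
Proof.
rewrite /fps_mul big_ord_recl subn0 big1 ?addr0 // => i _.
by rewrite /fps_const lift0 mul0r.
Qed.

Lemma fps_mulA_const (f g : fps) (a : rat) (n : nat) :
  fps_mul f (fps_mul (fps_const a) g) n = a * fps_mul f g n.
Proof.
rewrite /fps_mul big_distrr; apply: eq_bigr => i _ /=.
by rewrite -/(fps_mul _ _ _) fps_mul_const mulrCA.
Qed.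

Lemma fps_mul_exp_egf (c : nat -> nat) (n : nat) :
  fps_mul (fps_exp 2) (egf c) n = (binomial_transform c n)%:R / n`!%:R.
Proof.
rewrite /fps_mul natr_sum big_distrl; apply: eq_bigr => -[k /= lt_k] _.
have fact_neq0 m : m`!%:R != 0 :> rat by rewrite pnatr_eq0 -lt0n fact_gt0.
(* n! = C(n, k) k! (n - k)! *)
rewrite -(bin_fact (ltnSE lt_k)) !natrM natrX /fps_exp /egf.
have bin_neq0 : 'C(n, k)%:R != 0 :> rat by rewrite pnatr_eq0 -lt0n bin_gt0.
by field; rewrite ?fact_neq0 ?bin_neq0.
Qed.

Theorem theorem3p33 :
  egf (num_avoiding [:: [:: 1; 2; 3; 1]; [:: 1; 3; 2; 1]]%N)
  =1 fps_div (fps_const 2) (fps_sub (fps_const 3) (fps_exp 2)).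
Proof.
set c := num_avoiding _; set d := fps_sub _ _.
have d0 : d 0%N = 2 by [].
apply: (@fps_mul_inj d) => [|n]; first by rewrite d0.
rewrite fps_mulA_const fps_mulfV ?d0 //.
have -> : fps_mul d (egf c) n =
    fps_mul (fps_const 3) (egf c) n - fps_mul (fps_exp 2) (egf c) n.
  by rewrite -sumrB; apply: eq_bigr => i _; rewrite mulrBl.
rewrite fps_mul_const fps_mul_exp_egf /egf mulrA -mulrBl -natrM.
rewrite -num_avoiding_recurrence natrD addrAC subrr add0r /fps_const.
by case: n => [|n]; rewrite ?mul0r ?mulr0.
Qed.
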